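(* Fix nonzero integers $a_1,\dots,a_5$ with $a_1+\cdots+a_5=0$. For every $\varepsilon>0$ there exist $\delta>0$ and $n_0$ such that the following holds for all $n\ge n_0$. Suppose $X_1,\dots,X_5\subseteq\{1,\dots,n\}$ satisfy: (a) for each $i$, the number of nontrivial solutions $(x_1,x_2,x_3,x_4)\in X_i^4$ to $x_1+x_2=x_3+x_4$ is at most $\delta n$, where a solution is trivial if $(x_1,x_2)=(x_3,x_4)$ or $(x_1,x_2)=(x_4,x_3)$; and (b) the number of solutions to $a_1x_1+\cdots+a_5x_5=0$ with $x_1\in X_1,\dots,x_5\in X_5$ is at most $\delta n^{3/2}$. Then one can remove at most $\varepsilon\sqrt n$ elements from each $X_i$ so that, for the remaining sets $X_1',\dots,X_5'$, there is no solution to $a_1x_1+\cdots+a_5x_5=0$ with $x_1\in X_1',\dots,x_5\in X_5'$.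
   Context: In asymptotic form: $o(n)$ nontrivial additive quadruples in each $X_i$ and $o(n^{3/2})$ solutions imply that removing $o(\sqrt n)$ elements from each $X_i$ destroys all solutions. *)

(* Defs.v *)
From mathcomp Require Import all_boot all_order all_algebra.
From mathcomp Require Import reals.
Set Implicit Arguments. Unset Strict Implicit. Unset Printing Implicit Defensive.
Import Order.TTheory GRing.Theory Num.Theory.
Local Open Scope ring_scope.

(* Subsets of {1,...,n} are represented as sets X : {set 'I_n.+1} with 0 \notin X. *)

Definition nontriv_quads (n : nat) (X : {set 'I_n.+1}) : nat :=
  #|[set q : 'I_n.+1 * 'I_n.+1 * 'I_n.+1 * 'I_n.+1 |
      [&& q.1.1.1 \in X, q.1.1.2 \in X, q.1.2 \in X, q.2 \in X,
          (q.1.1.1 + q.1.1.2 == q.1.2 + q.2)%N &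
          ~~ (((q.1.1.1 == q.1.2) && (q.1.1.2 == q.2))
              || ((q.1.1.1 == q.2) && (q.1.1.2 == q.1.2)))]]|.

Definition lin_solutions (n : nat) (a : 'I_5 -> int) (X : 'I_5 -> {set 'I_n.+1}) : nat :=
  #|[set x : {ffun 'I_5 -> 'I_n.+1} |
      [forall i, x i \in X i] && (\sum_(i < 5) a i * (x i)%:Z == 0)]|.

(* Main.v *)
(** Dilating X_i by a_i modulo N = O(n) turns the problem into one on subsets S_i of a
    finite abelian group G of order N and the equation s_1 + ... + s_5 = 0.

    Having few nontrivial additive quadruples bounds the Fourier transforms of the S_i in
    l^4. It also gives, for every B of positive density, that the average of S_i over
    translates by B has sum of squares at most 2 once N is large. An energy increment
    along a sequence of Bohr-type sets therefore finds a coarse set B1 and a much finer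
    set B2 such that the smoothings of each S_i by b - b' with b, b' in B1, respectively
    B2, are close in L^2, while smoothing by B2 changes the number of solutions by an
    amount negligible even compared with a fixed power of the density of B1.

    Delete x from S_i when the B2-smoothing g_i of S_i is small at x + b - b' for more
    than 1/6 of the pairs (b, b') in B1 x B1. Few elements are deleted, because the
    B1-smoothing puts little mass where g_i is small. If a solution y survives, then for
    at least 1/6 of the u in B1^5 every g_i(y_i + u_i - u_(i+1)) is large; these points
    again sum to zero, which makes the number of solutions too large. *)

Require Import Defs.
From mathcomp Require Import all_boot all_order all_algebra.
From mathcomp Require Import reals.
From mathcomp Require Import cyclic separable cyclotomic complex.
From mathcomp Require Import ring lra zify.
Set Implicit Arguments. Unset Strict Implicit. Unset Printing Implicit Defensive.
Import Order.TTheory GRing.Theory Num.Theory.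
Local Open Scope ring_scope.

(** * Fourier analysis on a finite abelian group *)

(** Frequencies are indexed by [G] itself: each [e k] is a unitary character, and the last clause is
    orthogonality, summed over the characters. *)
Definition pairing (R : realType) (G : finZmodType) (e : G -> G -> R[i]) : Prop :=
  [/\ forall k x y, e k (x + y) = e k x * e k y,
      forall k x, e k x * conjc (e k x) = 1
    & forall x, \sum_k e k x = if x == 0 then #|G|%:R else 0].

Definition ind (R : realType) (T : finType) (S : {set T}) (x : T) : R :=
  (x \in S)%:R.

Definition corr (R : realType) (G : finZmodType) (f : G -> R) (d : G) : R :=
  \sum_x f (x + d) * f x.

(** Convolution with the law of [b - b']; taking differences makes the Fourier multiplier [mult B]
    real, with values in [0, 1]. *)
Definition smooth (R : realType) (G : finZmodType) (B : {set G}) (f : G -> R)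
  (x : G) : R :=
  (\sum_(b in B) \sum_(b' in B) f (x + (b - b'))) / #|B|%:R ^+ 2.

Definition zero_sum_count (R : realType) (G : finZmodType) (I : finType)
  (f : I -> G -> R) : R :=
  \sum_(x : {ffun I -> G} | \sum_i x i == 0) \prod_i f i (x i).

Section Fourier.
Local Open Scope complex_scope.
Variables (R : realType) (G : finZmodType) (e : G -> G -> R[i]).
Hypothesis eP : pairing e.

Definition fourier (f : G -> R) (k : G) : R[i] := \sum_x (f x)%:C * e k x.
Definition spec (f : G -> R) (k : G) : R := Normc.normc (fourier f k) ^+ 2.
Definition mult (B : {set G}) (k : G) : R := spec (ind R B) k / #|B|%:R ^+ 2.

Lemma pairingD k x y : e k (x + y) = e k x * e k y.
Proof. by case: eP. Qed.

Lemma pairing_conj k x : e k x * conjc (e k x) = 1.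
Proof. by case: eP. Qed.

Lemma pairing0 k : e k 0 = 1.
Proof.
have nz : e k 0 != 0.
  by apply: contra_eq_neq (pairing_conj k 0) => ->; rewrite mul0r eq_sym oner_eq0.
by apply: (mulfI nz); rewrite -pairingD addr0 mulr1.
Qed.

Lemma pairingN k x : e k (- x) = conjc (e k x).
Proof.
have nz : e k x != 0.
  by apply: contra_eq_neq (pairing_conj k x) => ->; rewrite mul0r eq_sym oner_eq0.
by apply: (mulfI nz); rewrite pairing_conj -pairingD subrr pairing0.
Qed.

Lemma norm_pairing k x : Normc.normc (e k x) = 1.
Proof.
have := pairing_conj k x; rewrite -sqr_normc => h.
have : (Normc.normc (e k x))%:C ^+ 2 = 1 by exact: h.
rewrite -rmorphXn /= => /complexI /eqP; rewrite sqrf_eq1 => /orP [/eqP //|/eqP h1].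
have : 0 <= Normc.normc (e k x) by case: (e k x) => a b /=; apply: sqrtr_ge0.
by rewrite h1 oppr_ge0 ler10.
Qed.

(** After expanding the product, orthogonality keeps exactly the tuples whose sum is 0. *)
Lemma sum_pairing (I : finType) (f : I -> G -> R) :
  \sum_k \prod_i fourier (f i) k =
  (#|G|%:R * zero_sum_count f)%:C.
Proof.
have prodE k (x : {ffun I -> G}) : \prod_i e k (x i) = e k (\sum_i x i).
  apply: esym; apply: (big_morph (e k) (pairingD k) (pairing0 k)).
under eq_bigr => k _.
  rewrite bigA_distr_bigA /=.
  under eq_bigr => x _ do rewrite big_split /= prodE -rmorph_prod.
  over.
rewrite exchange_big /= rmorphM rmorph_nat rmorph_sum mulr_sumr.
rewrite [RHS]big_mkcond /=; apply: eq_bigr => x _.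
rewrite -mulr_sumr; have [_ _ ->] := eP.
by case: ifP => _; rewrite ?mulr0 // mulrC.
Qed.

Lemma spec_ge0 f k : 0 <= spec f k.
Proof. exact: sqr_ge0. Qed.

Lemma mult_ge0 B k : 0 <= mult B k.
Proof. by rewrite divr_ge0 ?spec_ge0 ?sqr_ge0. Qed.

Lemma specE f k : (spec f k)%:C = fourier f k * conjc (fourier f k).
Proof. by rewrite -sqr_normc /spec rmorphXn. Qed.

Lemma fourier_conj f k : conjc (fourier f k) = \sum_x (f x)%:C * e k (- x).
Proof.
rewrite /fourier rmorph_sum; apply: eq_bigr => x _.
by rewrite rmorphM pairingN; congr (_ * _); exact: conjc_real.
Qed.

Lemma plancherel f g :
  \sum_k fourier f k * conjc (fourier g k) = (#|G|%:R * \sum_x f x * g x)%:C.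
Proof.
under eq_bigr => k _.
  rewrite fourier_conj /fourier mulr_suml.
  under eq_bigr => x _.
    rewrite mulr_sumr.
    under eq_bigr => y _ do rewrite mulrACA -pairingD.
    over.
  over.
rewrite exchange_big /= rmorphM rmorph_nat rmorph_sum mulr_sumr.
apply: eq_bigr => x _; rewrite exchange_big /= (bigD1 x) //= [X in _ + X]big1 => [|y yx].
  rewrite addr0 subrr -mulr_sumr; have [_ _ ->] := eP.
  by rewrite eqxx mulrC -rmorphM.
rewrite -mulr_sumr; have [_ _ ->] := eP.
by rewrite subr_eq0 eq_sym (negbTE yx) mulr0.
Qed.

Lemma parseval f : \sum_k spec f k = #|G|%:R * \sum_x f x ^+ 2.
Proof.
apply: (@complexI R); rewrite rmorph_sum /=.
under eq_bigr => k _ do rewrite specE.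
by rewrite plancherel; under [in RHS]eq_bigr => x _ do rewrite expr2.
Qed.

Lemma fourier_corr f k : fourier (corr f) k = (spec f k)%:C.
Proof.
rewrite specE fourier_conj /fourier /corr.
under eq_bigr => d _ do rewrite rmorph_sum mulr_suml.
rewrite exchange_big mulr_sumr /=; apply: eq_bigr => x _.
rewrite (reindex_inj (addIr (- x))) /= mulr_suml; apply: eq_bigr => d _.
by rewrite addrC subrK rmorphM pairingD mulrACA.
Qed.

(** [spec f] is the transform of [corr f], so this is Plancherel for correlations; it turns fourth
    moments of Fourier transforms into counts of additive quadruples. *)
Lemma plancherel_corr f g :
  \sum_k spec f k * spec g k = #|G|%:R * \sum_d corr f d * corr g d.
Proof.
apply: (@complexI R); rewrite -plancherel rmorph_sum /=.
by apply: eq_bigr => k _; rewrite !fourier_corr (conjc_real (spec g k)) rmorphM.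
Qed.

Lemma fourier_ind (B : {set G}) k : fourier (ind R B) k = \sum_(b in B) e k b.
Proof.
rewrite /fourier [RHS]big_mkcond; apply: eq_bigr => x _.
by rewrite /ind; case: ifP; rewrite ?mul1r ?mul0r.
Qed.

Lemma fourier_shift f d k :
  \sum_x (f (x + d))%:C * e k x = fourier f k * conjc (e k d).
Proof.
rewrite (reindex_inj (addIr (- d))) mulr_suml /=; apply: eq_bigr => x _.
by rewrite subrK pairingD pairingN mulrA.
Qed.

Lemma fourier_smooth B f k :
  fourier (smooth B f) k = fourier f k * (mult B k)%:C.
Proof.
rewrite /mult rmorphM /= specE mulrA {1}/fourier /smooth.
under eq_bigr => x _ do rewrite rmorphM mulrAC.
rewrite -mulr_suml; congr (_ * _).
transitivity (\sum_(b in B) \sum_(b' in B) fourier f k * (e k b' * conjc (e k b))).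
  under eq_bigr => x _.
    rewrite rmorph_sum mulr_suml.
    under eq_bigr => b _ do rewrite rmorph_sum mulr_suml.
    over.
  rewrite exchange_big /=; apply: eq_bigr => b _.
  rewrite exchange_big /=; apply: eq_bigr => b' _.
  by rewrite fourier_shift -pairingN opprB pairingD pairingN.
rewrite fourier_ind [X in _ = _ * X]mulr_suml [RHS]mulr_sumr exchange_big /=.
by apply: eq_bigr => b _; rewrite rmorph_sum !mulr_sumr.
Qed.

Lemma spec_smooth_diff B B' f k :
  spec (fun x => smooth B f x - smooth B' f x) k =
  spec f k * (mult B k - mult B' k) ^+ 2.
Proof.
have -> : spec (fun x => smooth B f x - smooth B' f x) k =
    Normc.normc (fourier f k * (mult B k - mult B' k)%:C) ^+ 2.
  congr (Normc.normc _ ^+ 2); rewrite rmorphB mulrBr -!fourier_smooth -sumrB.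
  by apply: eq_bigr => x _; rewrite rmorphB mulrBl.
rewrite Normc.normcM exprMn; congr (_ * _).
by rewrite /= expr0n addr0 sqr_sqrtr ?sqr_ge0.
Qed.

Lemma normc_fourier_le f k :
  (forall x, 0 <= f x) -> Normc.normc (fourier f k) <= \sum_x f x.
Proof.
move=> f0; rewrite -lecR rmorph_sum.
have h : `|fourier f k| = (Normc.normc (fourier f k))%:C by [].
rewrite -h; apply: le_trans (ler_norm_sum _ _ _) _; apply: ler_sum => x _.
have hx : `|e k x| = (Normc.normc (e k x))%:C by [].
by rewrite normrM hx norm_pairing mulr1 ger0_norm // ler0c.
Qed.

Lemma sum_ind (B : {set G}) : \sum_x ind R B x = #|B|%:R.
Proof.
rewrite -sum1_card natr_sum [RHS]big_mkcond; apply: eq_bigr => x _.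
by rewrite /ind; case: ifP.
Qed.

Lemma ind_ge0 (B : {set G}) x : 0 <= ind R B x.
Proof. exact: ler0n. Qed.

Lemma mult_le1 B k : mult B k <= 1.
Proof.
have [->|B0] := eqVneq B set0.
  by rewrite /mult cards0 expr0n invr0 mulr0 ler01.
have cB : 0 < #|B|%:R :> R by rewrite ltr0n card_gt0.
rewrite ler_pdivrMr ?exprn_gt0 // mul1r.
have h := normc_fourier_le k (ind_ge0 B); rewrite sum_ind in h.
rewrite ler_pXn2r // ?nnegrE ?ler0n //.
by case: (fourier _ k) => a b /=; apply: sqrtr_ge0.
Qed.

(** Smoothing every factor multiplies the term at frequency [k] by [mult B k ^+ #|I|]. The counts
    are real, so their difference is the real part of a sum over [k], bounded by its modulus. *)
Lemma smooth_count_le (I : finType) (B : {set G}) (f : I -> G -> R) :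
  #|G|%:R * zero_sum_count (fun i => smooth B (f i)) -
    \sum_k (\prod_i Normc.normc (fourier (f i) k)) * (1 - mult B k ^+ #|I|) <=
  #|G|%:R * zero_sum_count f.
Proof.
rewrite lerBlDl -lerBlDr.
have -> : #|G|%:R * zero_sum_count (fun i => smooth B (f i)) - #|G|%:R * zero_sum_count f =
  - complex.Re (\sum_k (\prod_i fourier (f i) k) * (1 - mult B k ^+ #|I|)%:C).
  rewrite -[LHS]opprK opprB; congr (- _).
  rewrite -[LHS]/(complex.Re (_ - _)%:C); congr complex.Re.
  rewrite rmorphB /= -!sum_pairing -sumrB; apply: eq_bigr => k _.
  under [X in _ - X]eq_bigr => i _ do rewrite fourier_smooth.
  by rewrite big_split /= -rmorph_prod prodr_const rmorphB rmorph1 mulrBr mulr1.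
set z := \sum_k _.
have zle : `|z| <= (\sum_k (\prod_i Normc.normc (fourier (f i) k)) * (1 - mult B k ^+ #|I|))%:C.
  rewrite rmorph_sum; apply: le_trans (ler_norm_sum _ _ _) _; apply: ler_sum => k _.
  rewrite normrM rmorphM rmorph_prod normr_prod.
  apply: ler_wpM2l => //; first by apply: prodr_ge0.
  by rewrite ger0_norm // ler0c subr_ge0 exprn_ile1 ?mult_ge0 ?mult_le1.
rewrite -lecR; apply: le_trans zle; apply: le_trans (normc_ge_Re z).
by rewrite lecR -normrN ler_norm.
Qed.

End Fourier.

(** * Additive quadruples *)

(* Given [x1 + x2 = x3 + x4], a quadruple is trivial iff [x1 = x3] or [x1 = x4]. *)
Definition group_quads (G : finZmodType) (S : {set G}) : nat :=
  #|[set q : G * G * G * G |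
      [&& q.1.1.1 \in S, q.1.1.2 \in S, q.1.2 \in S, q.2 \in S,
          q.1.1.1 + q.1.1.2 == q.1.2 + q.2,
          q.1.1.1 != q.1.2 & q.1.1.1 != q.2]]|.

Section Quads.
Variables (R : realType) (G : finZmodType).
Implicit Types (S B : {set G}) (d : G).

(** If [d] has [r] representations as a difference in [S], this is [r (r - 1)], the number of
    ordered pairs of distinct representations. *)
Definition excess S d : R := corr (ind R S) d ^+ 2 - corr (ind R S) d.

Lemma indM S x : ind R S x * ind R S x = ind R S x.
Proof. by rewrite /ind; case: (_ \in _); rewrite ?mulr1 ?mulr0. Qed.

Lemma excessE S d : excess S d =
  \sum_x \sum_(y | y != x)
    ind R S (x + d) * ind R S x * (ind R S (y + d) * ind R S y).
Proof.
rewrite /excess expr2 {1}/corr mulr_suml /corr -sumrB; apply: eq_bigr => x _.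
by rewrite mulr_sumr (bigD1 x) //= mulrACA !indM addrAC subrr add0r.
Qed.

Lemma excess_ge0 S d : 0 <= excess S d.
Proof.
rewrite excessE; apply: sumr_ge0 => x _; apply: sumr_ge0 => y _.
by rewrite !mulr_ge0 ?ind_ge0.
Qed.

Lemma corr_le_excess S d : corr (ind R S) d <= 1 + excess S d.
Proof.
by have := sqr_ge0 (corr (ind R S) d - 1); rewrite /excess sqrrB1; lra.
Qed.

(** Two representations of [d] with base points [x] and [y] give the quadruple
    [(x + d) + y = x + (y + d)], nontrivial because [d != 0] and [y != x]. *)
Lemma sum_excess S : \sum_(d | d != 0) excess S d <= (group_quads S)%:R.
Proof.
under eq_bigr => d _ do rewrite excessE.
pose T := [set t : G * (G * G) | [&& t.1 != 0, t.2.2 != t.2.1,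
  t.2.1 + t.1 \in S, t.2.1 \in S, t.2.2 + t.1 \in S & t.2.2 \in S]].
have -> : \sum_(d | d != 0) \sum_x \sum_(y | y != x)
    ind R S (x + d) * ind R S x * (ind R S (y + d) * ind R S y) = #|T|%:R.
  under eq_bigr => d _ do rewrite pair_big_dep.
  rewrite pair_big_dep -sum1_card natr_sum [LHS]big_mkcond [RHS]big_mkcond /=.
  apply: eq_bigr => -[d [x y]] _ /=; rewrite /ind inE /= -!natrM !mulnb.
  by case: (d != 0) => //=; case: (y != x) => //=; rewrite -andbA mulrb.
rewrite ler_nat.
pose h (t : G * (G * G)) := (t.2.1 + t.1, t.2.2, t.2.1, t.2.2 + t.1).
have hi : injective h.
  by move=> [d [x y]] [d' [x' y']] [] h1 -> h2 _; move: h1; rewrite h2 => /addrI ->.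
rewrite /group_quads -(card_imset _ hi); apply/subset_leq_card/subsetP => q.
case/imsetP => -[d [x y]]; rewrite inE /= => /and5P [d0 yx Sxd Sx /andP [Syd Sy]] ->.
rewrite inE /= Sxd Sy Sx Syd /= -addrA [d + y]addrC eqxx /=.
apply/andP; split; first by rewrite -subr_eq0 addrAC subrr add0r.
by apply: contra yx => /eqP /addIr ->.
Qed.

Lemma corr_ind_ge0 B d : 0 <= corr (ind R B) d.
Proof. by apply: sumr_ge0 => x _; rewrite mulr_ge0 ?ind_ge0. Qed.

Lemma corr_ind_le B d : corr (ind R B) d <= #|B|%:R.
Proof.
rewrite -sum_ind; apply: ler_sum => x _; rewrite ler_piMl ?ind_ge0 //.
by rewrite /ind lern1 leq_b1.
Qed.

Lemma corr_ind0 B : corr (ind R B) 0 = #|B|%:R.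
Proof. by rewrite -sum_ind; apply: eq_bigr => x _; rewrite addr0 indM. Qed.

Lemma sum_corr_ind B : \sum_d corr (ind R B) d = #|B|%:R ^+ 2.
Proof.
rewrite exchange_big expr2 -{2}sum_ind mulr_sumr; apply: eq_bigr => x _.
by rewrite -mulr_suml -[in RHS]sum_ind [in RHS](reindex_inj (addrI x)).
Qed.

Lemma card_sqr_le S : #|S|%:R ^+ 2 <= #|S|%:R + #|G|%:R + (group_quads S)%:R :> R.
Proof.
rewrite -sum_corr_ind (bigD1 0) //= corr_ind0 -addrA lerD2l.
apply: le_trans (lerD (lexx _) (sum_excess S)).
have -> : #|G|%:R = \sum_(d : G) (1 : R) by rewrite sumr_const.
rewrite [X in _ <= X + _](bigD1 0) //= -addrA -big_split /= ler_wpDl //.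
by apply: ler_sum => d _; apply: corr_le_excess.
Qed.

Lemma card_sqr_le4 S :
  (group_quads S)%:R <= #|G|%:R :> R -> #|S|%:R ^+ 2 <= 4 * #|G|%:R :> R.
Proof.
move=> gq; have h := card_sqr_le S.
have G1 : 1 <= #|G|%:R :> R by rewrite ler1n; apply/card_gt0P; exists 0.
have [s2|] := leqP 2 #|S|; last first.
  rewrite ltnS -(ler_nat R) => s1; have := ler0n R #|S|; nra.
move: s2; rewrite -(ler_nat R) => s2; nra.
Qed.

(** By [plancherel_corr] the sum is [#|G|] times the sum of [corr ^+ 2]. The difference 0 gives at
    most [4 * #|G|]; elsewhere [corr ^+ 2 = corr + excess], with sums at most [4 * #|G|] and
    [#|G|]. *)
Lemma energy_le (e : G -> G -> R[i]) S : pairing e ->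
  (group_quads S)%:R <= #|G|%:R :> R ->
  \sum_k spec e (ind R S) k ^+ 2 <= 9 * #|G|%:R ^+ 2.
Proof.
move=> eP gq; under eq_bigr => k _ do rewrite expr2.
rewrite plancherel_corr // expr2 mulrCA ler_wpM2l ?ler0n //.
have c4 := card_sqr_le4 gq.
have -> : \sum_d corr (ind R S) d * corr (ind R S) d =
   #|S|%:R ^+ 2 + (\sum_(d | d != 0) corr (ind R S) d + \sum_(d | d != 0) excess S d).
  rewrite (bigD1 0) //= corr_ind0 -expr2; congr (_ + _).
  by rewrite -big_split /=; apply: eq_bigr => d _; rewrite /excess expr2 addrC subrK.
have h1 : \sum_(d | d != 0) corr (ind R S) d <= #|S|%:R ^+ 2.
  by rewrite -sum_corr_ind [leRHS](bigD1 0) //= ler_wpDl // corr_ind_ge0.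
by have := sum_excess S; lra.
Qed.

(** By Parseval the left side is [#|G|] times the sum of squares of the averages of [S] over
    translates of [B]. On the correlation side, [d = 0] gives [#|S| * #|B|], and [corr_le_excess]
    bounds the rest by [#|B| ^+ 2] plus [#|B|] times the number of quadruples. *)
Lemma sum_spec_mult_le (e : G -> G -> R[i]) S B : pairing e ->
  #|S|%:R + (group_quads S)%:R <= #|B|%:R :> R -> (0 < #|B|)%N ->
  \sum_k spec e (ind R S) k * mult e B k <= 2 * #|G|%:R.
Proof.
move=> eP le_B B0; rewrite /mult.
under eq_bigr => k _ do rewrite mulrA.
rewrite -mulr_suml plancherel_corr // ler_pdivrMr ?exprn_gt0 ?ltr0n //.
rewrite [2 * _]mulrC -mulrA ler_wpM2l ?ler0n //.
rewrite (bigD1 0) //= !corr_ind0.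
have h : \sum_(d | d != 0) corr (ind R S) d * corr (ind R B) d <=
   #|B|%:R ^+ 2 + (group_quads S)%:R * #|B|%:R.
  apply: (@le_trans _ _ (\sum_(d | d != 0) (corr (ind R B) d + excess S d * #|B|%:R))).
    apply: ler_sum => d _; have := corr_ind_ge0 B d; have := corr_ind_le B d.
    have := excess_ge0 S d.
    have := corr_le_excess S d.
    by move: (corr (ind R S) d) (corr (ind R B) d) (excess S d) (#|B|%:R) => a b c n; nra.
  rewrite big_split /= -mulr_suml lerD //; last by rewrite ler_wpM2r ?sum_excess.
  by rewrite -sum_corr_ind [leRHS](bigD1 0) //= ler_wpDl // corr_ind_ge0.
have : 0 <= #|B|%:R :> R by [].
nra.
Qed.

End Quads.

(** * Bohr-type sets *)

Lemma large_fiber (T C : finType) (f : T -> C) : (0 < #|T|)%N ->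
  exists c, (0 < #|f @^-1: [set c]|)%N /\ (#|T| <= #|f @^-1: [set c]| * #|C|)%N.
Proof.
move=> T0; case: (pickP (fun c => (#|T| <= #|f @^-1: [set c]| * #|C|)%N)) => [c cP|no].
  by exists c; split => //; case: #|_ @^-1: _| cP => //; rewrite mul0n leqNgt T0.
have C0 : (0 < #|C|)%N by case/card_gt0P: T0 => x _; apply/card_gt0P; exists (f x).
have : (\sum_(c : C) #|f @^-1: [set c]| * #|C| < \sum_(c : C) #|T|)%N.
  have lt c : (#|f @^-1: [set c]| * #|C| < #|T|)%N by rewrite ltnNge no.
  case/card_gt0P: C0 => c0 _; rewrite (bigD1 c0) //= [leqRHS](bigD1 c0) //=.
  by rewrite -addSn leq_add // leq_sum // => c _; apply: ltnW.
rewrite -big_distrl sum_nat_const /= mulnC ltn_pmul2l //.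
suff -> : (\sum_(c : C) #|f @^-1: [set c]| = #|T|)%N by rewrite ltnn.
rewrite -[RHS]sum1_card (partition_big f predT) //=; apply: eq_bigr => c _.
by rewrite -sum1_card; apply: eq_bigl => x; rewrite !inE.
Qed.

Section Cells.
Variables (R : realType) (L : nat).
Hypothesis L0 : (0 < L)%N.

(** Cuts [-1, 1] into pieces of length [1/L]; the index [2L] is reached only at [t = 1], whence
    [2L + 1] values. *)
Definition cell1 (t : R) : 'I_(L.*2.+1) := inord (Num.trunc ((t + 1) * L%:R)).
Definition cell (z : R[i]) := (cell1 (complex.Re z), cell1 (complex.Im z)).

Lemma cell1_close (s t : R) : `|s| <= 1 -> `|t| <= 1 -> cell1 s = cell1 t ->
  (s - t) ^+ 2 <= (L%:R ^+ 2)^-1.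
Proof.
rewrite !ler_norml => /andP [s1 s2] /andP [t1 t2] /(congr1 val) /=.
have Lp : 0 < L%:R :> R by rewrite ltr0n.
have trle (u : R) : -1 <= u -> u <= 1 -> (Num.trunc ((u + 1) * L%:R) < L.*2.+1)%N.
  move=> u1 u2; rewrite ltnS truncn_le_nat -addn1 natrD -mul2n natrM; nra.
rewrite !inordK ?trle // => E.
have := @truncn_itv R ((s + 1) * L%:R); have := @truncn_itv R ((t + 1) * L%:R).
rewrite E => /(_ _)/andP [|h1 h2]; first by apply: mulr_ge0; lra.
move=> /(_ _)/andP [|h3 h4]; first by apply: mulr_ge0; lra.
rewrite -exprVn -real_normK ?num_real // ler_pXn2r ?nnegrE ?invr_ge0 ?ler0n //.
rewrite -[leRHS]mul1r ler_pdivlMr // -[X in `|_| * X](gtr0_norm Lp) -normrM.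
by rewrite ler_norml; move: h1 h2 h3 h4; rewrite -natr1; nra.
Qed.

End Cells.

Section Bohr.
Variables (R : realType) (G : finZmodType) (e : G -> G -> R[i]).
Hypothesis eP : pairing e.

Lemma pairing_ReIm k x : complex.Re (e k x) ^+ 2 + complex.Im (e k x) ^+ 2 = 1.
Proof.
have := norm_pairing eP k x; case: (e k x) => a b /= /(congr1 (fun t => t ^+ 2)).
by rewrite sqr_sqrtr ?addr_ge0 ?sqr_ge0 // expr1n.
Qed.

Lemma spec_ind_ReIm (B : {set G}) k : spec e (ind R B) k =
  \sum_(b in B) \sum_(b' in B) (complex.Re (e k b) * complex.Re (e k b') +
     complex.Im (e k b) * complex.Im (e k b')).
Proof.
have ReImS : fourier e (ind R B) k = Complex (\sum_(b in B) complex.Re (e k b))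
    (\sum_(b in B) complex.Im (e k b)).
  rewrite fourier_ind; elim/big_rec3: _ => // b x1 x2 x3 _ ->.
  by case: (e k b).
rewrite /spec ReImS /= sqr_sqrtr ?addr_ge0 ?sqr_ge0 //.
rewrite !expr2 !mulr_suml -big_split /=; apply: eq_bigr => b _.
by rewrite !mulr_sumr -big_split.
Qed.

(* [B] is a popular class of points whose characters in [K] fall in the same cells of
   side [1/L]; it need not be symmetric or contain 0, since only [B - B] matters. *)
Lemma bohr_set (L : nat) (K : {set G}) : (0 < L)%N ->
  exists B : {set G}, [/\ (0 < #|B|)%N,
    (#|G| <= #|B| * (L.*2.+1 * L.*2.+1) ^ #|K|)%N &
    forall k, k \in K -> 1 - (L%:R ^+ 2)^-1 <= mult e B k].
Proof.
move=> L0.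
pose f (x : G) := [ffun k : {k | k \in K} => cell L (e (val k) x)].
have [c [B0 leB]] : exists c, (0 < #|f @^-1: [set c]|)%N /\
    (#|G| <= #|f @^-1: [set c]| * (L.*2.+1 * L.*2.+1) ^ #|K|)%N.
  have [|c [c1 c2]] := large_fiber f; first by apply/card_gt0P; exists 0.
  exists c; split => //; move: c2.
  by rewrite card_ffun card_prod !card_ord card_sig.
exists (f @^-1: [set c]); split => // k kK; set B := f @^-1: _ in B0 leB *.
rewrite /mult ler_pdivlMr ?exprn_gt0 ?ltr0n // spec_ind_ReIm.
have -> : (1 - (L%:R ^+ 2)^-1) * #|B|%:R ^+ 2 =
    \sum_(b in B) \sum_(b' in B) (1 - (L%:R ^+ 2)^-1) :> R.
  rewrite !sumr_const -mulrnA.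
  by move: (1 - _) => q; rewrite -(mulr_natr q) natrM expr2.
apply: ler_sum => b; rewrite !inE => /eqP fb; apply: ler_sum => b'.
rewrite !inE -fb => /eqP /ffunP /(_ (exist _ k kK)); rewrite !ffunE /= => -[h1 h2].
(* Unit vectors [u], [v] whose coordinates differ by at most [1/L] have inner product at least
   [1 - 1/L^2], since [|u - v|^2 = 2 - 2 <u, v>]. *)
have := pairing_ReIm k b; have := pairing_ReIm k b'.
have bd (u v : R) : u ^+ 2 + v ^+ 2 = 1 -> `|u| <= 1 /\ `|v| <= 1.
  move=> h; have := sqr_ge0 u; have := sqr_ge0 v.
  by split; rewrite -(ler_pXn2r (n := 2)) ?nnegrE // real_normK ?num_real // expr1n; lra.
have [a1 a2] := bd _ _ (pairing_ReIm k b); have [a3 a4] := bd _ _ (pairing_ReIm k b').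
have := cell1_close L0 a3 a1 h1; have := cell1_close L0 a4 a2 h2.
move: (_^-1) => q; nra.
Qed.

Lemma card_superlevel_le (F : G -> R) (t s : R) : 0 < t -> (forall k, 0 <= F k) ->
  \sum_k F k <= s -> #|[set k | t <= F k]|%:R <= s / t.
Proof.
move=> t0 F0 Fs; rewrite ler_pdivlMr //; apply: le_trans Fs.
rewrite mulr_natl -sumr_const [leRHS](bigID (fun k => k \in [set k | t <= F k])) /=.
by rewrite -[leLHS]addr0 lerD ?sumr_ge0 //; apply: ler_sum => k; rewrite inE.
Qed.

End Bohr.

(** The number of frequencies to control is bounded independently of [G]: at most [9 / eta^2] come
    from [S] by the fourth moment, and at most [1 / (c kappa)] from [B] by Parseval. So a Bohr-type
    set for all of them has density bounded below. *)
Lemma refine_bohr (R : realType) (c kappa eta rho : R) :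
  0 < c -> 0 < kappa -> 0 < eta -> 0 < rho ->
  exists c' : R, 0 < c' /\
  forall (G : finZmodType) (e : G -> G -> R[i]) (S B : {set G}), pairing e ->
  \sum_k spec e (ind R S) k ^+ 2 <= 9 * #|G|%:R ^+ 2 ->
  c * #|G|%:R <= #|B|%:R ->
  exists B' : {set G}, c' * #|G|%:R <= #|B'|%:R /\
    forall k, eta * #|G|%:R <= spec e (ind R S) k \/ kappa <= mult e B k ->
      1 - rho <= mult e B' k.
Proof.
move=> c0 k0 e0 r0.
(* [L >= 1] exceeds [1 / rho], so [1 / L^2 <= rho]; [d] exceeds the number of frequencies to
   control. *)
pose L := (Num.trunc rho^-1).+1.
pose d := (Num.trunc (9 / eta ^+ 2 + (c * kappa)^-1)).+1.
have ML : (0 < L.*2.+1 * L.*2.+1)%N by [].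
exists ((((L.*2.+1 * L.*2.+1) ^ d)%N%:R : R)^-1); split.
  by rewrite invr_gt0 ltr0n expn_gt0 ML.
move=> G e S B eP en cB.
have G0 : 0 < #|G|%:R :> R by rewrite ltr0n; apply/card_gt0P; exists 0.
have B0 : 0 < #|B|%:R :> R by apply: lt_le_trans cB; rewrite mulr_gt0.
pose K1 := [set k | (eta * #|G|%:R) ^+ 2 <= spec e (ind R S) k ^+ 2].
pose K2 := [set k | kappa <= mult e B k].
have cK1 : #|K1|%:R <= 9 / eta ^+ 2.
  have := card_superlevel_le _ _ en => /(_ ((eta * #|G|%:R) ^+ 2)).
  rewrite -/K1 exprn_gt0 ?mulr_gt0 // => /(_ isT (fun k => sqr_ge0 _)).
  by rewrite exprMn invfM mulrCA mulfK ?lt0r_neq0 ?exprn_gt0 // mulrC.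
have cK2 : #|K2|%:R <= (c * kappa)^-1.
  have h : \sum_k mult e B k <= c^-1.
    rewrite /mult -mulr_suml (parseval eP).
    have -> : \sum_x ind R B x ^+ 2 = #|B|%:R.
      by rewrite -sum_ind; apply: eq_bigr => x _; rewrite expr2 indM.
    rewrite ler_pdivrMr ?exprn_gt0 // expr2 mulrA ler_wpM2r ?ler0n //.
    by rewrite mulrC ler_pdivlMr // mulrC.
  by have := card_superlevel_le k0 (mult_ge0 e B) h; rewrite -/K2 invfM.
have [|B' [B'0 cB' B'P]] := @bohr_set R G e eP L (K1 :|: K2) => //.
exists B'; split.
  rewrite mulrC ler_pdivrMr ?ltr0n ?expn_gt0 ?ML // -natrM ler_nat.
  apply: leq_trans cB' _; rewrite leq_mul2l; apply/orP; right.
  apply: leq_pexp2l => //; apply: leq_trans (leq_card_setU _ _) _.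
  rewrite -(ler_nat R) natrD; apply/ltW.
  by apply: le_lt_trans (lerD cK1 cK2) _; apply: truncnS_gt.
move=> k hk; apply: le_trans (B'P k _).
  rewrite lerD2l lerN2.
  have L1 : rho^-1 <= L%:R by apply/ltW/truncnS_gt.
  have L2 : 1 <= L%:R :> R by rewrite ler1n.
  rewrite -[rho]invrK lef_pV2 ?posrE ?exprn_gt0 ?invr_gt0 ?ltr0n //.
  by rewrite expr2; nra.
rewrite !inE; apply/orP; case: hk => hk; [left|by right].
by rewrite ler_pXn2r ?nnegrE ?spec_ge0 ?mulr_ge0 ?ler0n // ltW.
Qed.

(** * The energy increment *)

Section Energy.
Variables (R : realType) (G : finZmodType) (e : G -> G -> R[i]) (I : finType).
Hypothesis eP : pairing e.
Implicit Types (S : I -> {set G}) (B : {set G}).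

(** By Parseval, [#|G|] times the sum of the squared L2 norms of the smoothings; [gap] is likewise a
    squared L2 distance between two families of smoothings. *)
Definition energy S B : R :=
  \sum_i \sum_k spec e (ind R (S i)) k * mult e B k ^+ 2.

Definition gap S B B' : R :=
  \sum_i \sum_k spec e (ind R (S i)) k * (mult e B k - mult e B' k) ^+ 2.

Definition l2_bounded S B : Prop :=
  forall i, \sum_k spec e (ind R (S i)) k * mult e B k <= 2 * #|G|%:R.

Lemma energy_ge0 S B : 0 <= energy S B.
Proof.
by apply: sumr_ge0 => i _; apply: sumr_ge0 => k _; rewrite mulr_ge0 ?spec_ge0 ?sqr_ge0.
Qed.

Lemma sum_l2_bounded S B : l2_bounded S B ->
  \sum_i \sum_k spec e (ind R (S i)) k * mult e B k <= 2 * #|I|%:R * #|G|%:R.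
Proof.
move=> h; have -> : 2 * #|I|%:R * #|G|%:R = \sum_(i : I) 2 * #|G|%:R :> R.
  by rewrite sumr_const -[RHS]mulr_natl; ring.
by apply: ler_sum => i _; apply: h.
Qed.

Lemma energy_le_l2 S B : l2_bounded S B -> energy S B <= 2 * #|I|%:R * #|G|%:R.
Proof.
move=> /sum_l2_bounded; apply: le_trans; apply: ler_sum => i _; apply: ler_sum => k _.
apply: ler_wpM2l; first exact: spec_ge0.
by rewrite expr2 ler_piMl ?mult_ge0 ?mult_le1.
Qed.

(* With b, b' the two multipliers, [b - b' <= kappa] gives
   (b - b')^2 = b'^2 - b^2 + 2 b (b - b') <= b'^2 - b^2 + 2 kappa b. *)
Lemma gap_le_increment S B B' kappa : l2_bounded S B -> 0 < kappa ->
  (forall k, kappa <= mult e B k -> 1 - kappa <= mult e B' k) ->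
  gap S B B' <= energy S B' - energy S B + 4 * kappa * #|I|%:R * #|G|%:R.
Proof.
move=> /sum_l2_bounded h k0 near.
have h2 : 2 * kappa * (\sum_i \sum_k spec e (ind R (S i)) k * mult e B k) <=
    4 * kappa * #|I|%:R * #|G|%:R by nra.
apply: le_trans (lerD (lexx _) h2).
rewrite /gap /energy -sumrB mulr_sumr -big_split /=; apply: ler_sum => i _.
rewrite -sumrB mulr_sumr -big_split /=; apply: ler_sum => k _.
rewrite -mulrBr [2 * kappa * _]mulrCA -mulrDr; apply: ler_wpM2l; first exact: spec_ge0.
(* PLACEHOLDER *)
have := mult_ge0 e B k; have := mult_ge0 e B' k; have := mult_le1 eP B k.
(* Either [b >= kappa], and then [b - b' <= 1 - (1 - kappa)], or [b - b' <= b < kappa]. *)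
have := near k; case: (lerP kappa (mult e B k)) => [_ /(_ isT)|+ _]; nra.
Qed.

End Energy.

(* Induction on the number [J] of increments [t/2] of the energy still possible. *)
Lemma energy_increment (R : realType) (I : finType) (t : R) (eta rho : R -> R)
    (J : nat) : (0 < #|I|)%N -> 0 < t ->
  (forall c, 0 < c -> 0 < eta c) -> (forall c, 0 < c -> 0 < rho c) ->
  forall c, 0 < c -> exists c0 : R, [/\ 0 < c0, c0 <= c &
  forall (G : finZmodType) (e : G -> G -> R[i]) (S : I -> {set G}) (i0 : I)
    (B : {set G}), pairing e ->
  (forall i, \sum_k spec e (ind R (S i)) k ^+ 2 <= 9 * #|G|%:R ^+ 2) ->
  (forall B : {set G}, c0 * #|G|%:R <= #|B|%:R -> l2_bounded e S B) ->
  c * #|G|%:R <= #|B|%:R ->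
  (2 * #|I|%:R - J%:R * (t / 2)) * #|G|%:R < energy e S B ->
  exists (c1 : R) (B1 B2 : {set G}),
    [/\ c0 <= c1, c1 * #|G|%:R <= #|B1|%:R, gap e S B1 B2 <= t * #|G|%:R &
    forall k, eta c1 * #|G|%:R <= spec e (ind R (S i0)) k ->
      1 - rho c1 <= mult e B2 k]].
Proof.
move=> I0 t0 eta0 rho0; elim: J => [|J IH] c cp.
  (* With no increment left, the assumed lower bound on the energy contradicts [energy_le_l2]. *)
  exists c; split=> // G e S i0 B eP _ l2 cB.
  by rewrite mul0r subr0 ltNge (energy_le_l2 eP (l2 _ cB)).
have Ip : 0 < #|I|%:R :> R by rewrite ltr0n.
(* The error term of [gap_le_increment] becomes [t / 2 * #|G|], so a gap above [t * #|G|] raises the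
   energy by more than [t / 2 * #|G|]. *)
pose kappa := t / (8 * #|I|%:R).
have kp : 0 < kappa by rewrite divr_gt0 // mulr_gt0.
have rp : 0 < Num.min (rho c) kappa by rewrite lt_min kp rho0.
have [c' [cp' refine]] := refine_bohr cp kp (eta0 c cp) rp.
have [c0 [c0p c0c' step]] := IH c' cp'.
(* The minimum keeps the L2 bound available for the present [B] as well as for all later ones. *)
exists (Num.min c c0); split; first by rewrite lt_min cp.
  by rewrite ge_min lexx.
move=> G e S i0 B eP en l2 cB eB.
have G0 : 0 < #|G|%:R :> R by rewrite ltr0n; apply/card_gt0P; exists 0.
have [B' [cB' nearB']] := refine G e (S i0) B eP (en i0) cB.
have minc x : c <= x -> Num.min c c0 <= x by move=> h; rewrite ge_min h.
have minc0 x : c0 <= x -> Num.min c c0 <= x by move=> h; rewrite ge_min h orbT.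
have l2B : l2_bounded e S B.
  by apply: l2; apply: le_trans cB; rewrite ler_wpM2r ?minc ?ler0n.
have [gapt|gapt] := lerP (gap e S B B') (t * #|G|%:R).
  exists c, B, B'; split => //; first exact: minc.
  move=> k hk; apply: le_trans (nearB' k (or_introl hk)).
  by rewrite lerD2l lerN2 ge_min lexx.
have [] := step G e S i0 B' eP en _ cB' _.
- by move=> B2 cB2; apply: l2; apply: le_trans cB2; rewrite ler_wpM2r ?minc0 ?ler0n.
- have := gap_le_increment eP l2B kp (B' := B').
  have -> : 4 * kappa * #|I|%:R * #|G|%:R = t / 2 * #|G|%:R.
    by rewrite /kappa; field; rewrite lt0r_neq0.
  have near k : kappa <= mult e B k -> 1 - kappa <= mult e B' k.
    move=> hk; apply: le_trans (nearB' k (or_intror hk)).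
    by rewrite lerD2l lerN2 ge_min lexx orbT.
  move=> /(_ near); move: eB gapt; rewrite -(natr1 J); lra.
- move=> c1 [B1 [B2 [h1 h2 h3 h4]]]; exists c1, B1, B2; split => //.
  exact: minc0.
Qed.

(** [c0] does not depend on [G], while the tolerances are functions of the density bound [c1] found
    for the given [G]; this lets the fine scale beat a power of the coarse density. *)
Lemma two_scales (R : realType) (I : finType) (t : R) (eta rho : R -> R) :
  (0 < #|I|)%N -> 0 < t ->
  (forall c, 0 < c -> 0 < eta c) -> (forall c, 0 < c -> 0 < rho c) ->
  exists c0 : R, 0 < c0 /\
  forall (G : finZmodType) (e : G -> G -> R[i]) (S : I -> {set G}) (i0 : I),
  pairing e ->
  (forall i, \sum_k spec e (ind R (S i)) k ^+ 2 <= 9 * #|G|%:R ^+ 2) ->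
  (forall B : {set G}, c0 * #|G|%:R <= #|B|%:R -> l2_bounded e S B) ->
  exists (c1 : R) (B1 B2 : {set G}),
    [/\ c0 <= c1, c1 * #|G|%:R <= #|B1|%:R, gap e S B1 B2 <= t * #|G|%:R &
    forall k, eta c1 * #|G|%:R <= spec e (ind R (S i0)) k ->
      1 - rho c1 <= mult e B2 k].
Proof.
move=> I0 t0 eta0 rho0.
(* [J] increments of [t / 2] exceed the maximal energy [2 * #|I|], so the energy hypothesis is
   automatic for the starting set [setT], of density 1. *)
pose J := (Num.trunc (2 * #|I|%:R / (t / 2))).+1.
have [c0 [c0p _ h]] := energy_increment J I0 t0 eta0 rho0 ltr01.
exists c0; split=> // G e S i0 eP en l2.
apply: (h G e S i0 setT eP en l2); first by rewrite mul1r cardsT.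
apply: lt_le_trans (energy_ge0 e S setT).
have G0 : 0 < #|G|%:R :> R by rewrite ltr0n; apply/card_gt0P; exists 0.
rewrite pmulr_llt0 // subr_lt0 -ltr_pdivrMr ?divr_gt0 //.
exact: truncnS_gt.
Qed.

(** * Solutions near a surviving solution *)

(** Fibring over [(u i, u j)]: each pair leaves the other coordinates free in [B]. *)
Lemma card_ffun_on_pair (I T : finType) (B : {set T}) (i j : I)
    (P : pred (T * T)) : i != j ->
  #|[set u : {ffun I -> T} in ffun_on (mem B) | P (u i, u j)]| =
  (#|[set p in setX B B | P p]| * #|B| ^ #|[pred k | (k != i) && (k != j)]|)%N.
Proof.
move=> ij; rewrite -sum1_card -sum_nat_const.
rewrite (partition_big (fun u : {ffun I -> T} => (u i, u j))
  (fun p => p \in [set p in setX B B | P p])) /=; last first.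
  by move=> u; rewrite !inE => /andP [/ffun_onP uB ->]; rewrite !uB.
apply: eq_bigr => -[b b']; rewrite !inE /= => /andP [/andP [Bb Bb'] Pb].
pose F k : pred T := if k == i then pred1 b else if k == j then pred1 b' else mem B.
rewrite (eq_bigl (mem (family F))) => [|u]; last first.
  rewrite !inE; apply/idP/familyP => [/andP [/andP [/ffun_onP uB _]] /eqP [ui uj] k|uF].
    rewrite /F; case: eqP => [->|_]; first exact/eqP.
    by case: eqP => [->|_]; [exact/eqP|exact: uB].
  have ui : u i = b by have := uF i; rewrite /F eqxx => /eqP.
  have uj : u j = b' by have := uF j; rewrite /F eqxx eq_sym (negbTE ij) => /eqP.
  rewrite ui uj Pb eqxx !andbT; apply/ffun_onP => k; have := uF k; rewrite /F.
  by case: eqP => [_ /eqP -> //|_]; case: eqP => [_ /eqP -> //|].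
rewrite sum1_card card_family foldrE big_map big_enum /=.
rewrite (bigD1 i) //= (bigD1 j) 1?eq_sym //= /F !eqxx eq_sym (negbTE ij) !card1 !mul1n.
rewrite -[in RHS]prod_nat_const; apply: eq_bigr => k /andP [/negbTE -> /negbTE ->].
by [].
Qed.

Section CyclicShift.
Variables (R : realType) (G : finZmodType) (n : nat).

(** The perturbations cancel around the cycle, so the sum of [y] is preserved, and each is a
    difference of two coordinates of [u], as in [smooth]. *)
Definition cyclic_shift (y u : {ffun 'I_n.+2 -> G}) : {ffun 'I_n.+2 -> G} :=
  [ffun i => y i + (u i - u (ordS i))].

Lemma ordS_inj : injective (@ordS n.+2).
Proof. exact: (can_inj (@ordSK _)). Qed.

Lemma ordS_neq (i : 'I_n.+2) : i != ordS i.
Proof.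
apply/eqP => /(congr1 val) /=; have := ltn_ord i.
rewrite ltnS leq_eqVlt => /orP [/eqP ->|lt]; first by rewrite modnn.
by rewrite modn_small // => /eqP; rewrite eqn_leq ltnn andbF.
Qed.

Lemma sum_cyclic_shift y u : \sum_i cyclic_shift y u i = \sum_i y i.
Proof.
under eq_bigr => i _ do rewrite ffunE.
rewrite !big_split /= sumrN [X in _ - X](_ : _ = \sum_i u i) ?subrr ?addr0 //.
by rewrite [RHS](reindex_inj ordS_inj).
Qed.

(** Consecutive differences determine [u] up to a constant, which the value at [ord0] fixes. *)
Lemma cyclic_shift_inj y u u' :
  cyclic_shift y u = cyclic_shift y u' -> u ord0 = u' ord0 -> u = u'.
Proof.
move=> /ffunP E E0; apply/ffunP => i; rewrite -(inord_val i).
elim: (i : nat) (ltn_ord i) => [_|m IH lt_m].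
  by rewrite (_ : inord 0 = ord0) //; apply: val_inj; rewrite /= inordK.
have Sm : inord m.+1 = ordS (inord m : 'I_n.+2).
  by apply: val_inj; rewrite /= !inordK ?modn_small // ltnW.
have := E (inord m); rewrite !ffunE => /addrI; rewrite (IH (ltnW lt_m)) -Sm.
by move=> /addrI /oppr_inj.
Qed.

(** Each of the [n.+2] coordinates is bad for at most a fraction [1 / n.+3] of the tuples [u] over
    [B], so at least that fraction is good everywhere. Good [u] give zero-sum tuples with all values
    above [tau], each arising from at most [#|G|] of them. *)
Lemma zero_sum_count_ge (B : {set G}) (g : 'I_n.+2 -> G -> R) (tau : R)
    (y : {ffun 'I_n.+2 -> G}) :
  0 <= tau -> (forall i x, 0 <= g i x) -> \sum_i y i = 0 ->
  (forall i, n.+3 * #|[set p in setX B B | (g i (y i + (p.1 - p.2)) <= tau)%R]|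
     <= #|B| ^ 2)%N ->
  (#|B|%:R * tau) ^+ n.+2 <= n.+3%:R * #|G|%:R * zero_sum_count g.
Proof.
move=> tau0 g0 y0 few.
pose bad i := [set u : {ffun 'I_n.+2 -> G} in ffun_on (mem B) |
  (g i (y i + (u i - u (ordS i))) <= tau)%R].
pose good := [set u : {ffun 'I_n.+2 -> G} in ffun_on (mem B) |
  [forall i, (tau < g i (y i + (u i - u (ordS i))))%R]].
pose Z := [set x : {ffun 'I_n.+2 -> G} | (\sum_i x i == 0) &&
  [forall i, (tau < g i (x i))%R]].
have cbad i : (n.+3 * #|bad i| <= #|B| ^ n.+2)%N.
  have -> := @card_ffun_on_pair _ _ B i (ordS i)
    (fun p => (g i (y i + (p.1 - p.2)) <= tau)%R) (ordS_neq i).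
  have -> : #|[pred k | (k != i) && (k != ordS i)]| = n.
    have := cardC [pred k | (k == i) || (k == ordS i)]; rewrite card_ord.
    rewrite (@eq_card _ _ (mem [:: i; ordS i])); last by move=> k; rewrite !inE.
    rewrite (card_uniqP _) /= ?inE ?ordS_neq // => /(@addnI 2 _ n) h.
    by rewrite -[RHS]h; apply: eq_card => k; rewrite !inE negb_or.
  by rewrite mulnA -[leqRHS]/(#|B| ^ (2 + n))%N expnD leq_mul2r few orbT.
have cgood : (#|B| ^ n.+2 <= n.+3 * #|good|)%N.
  have cover : [set u : {ffun 'I_n.+2 -> G} in ffun_on (mem B)] \subset
      good :|: \bigcup_i bad i.
    apply/subsetP => u; rewrite !inE => uB; rewrite uB /=.
    case: (boolP [forall i, (tau < g i (y i + (u i - u (ordS i))))%R]) => //=.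
    case/forallPn => i.
    by rewrite -leNgt => gi; apply/bigcupP; exists i => //; rewrite !inE uB.
  have := subset_leq_card cover; rewrite cardsE card_ffun_on card_ord => c1.
  have {}c1 := leq_trans c1 (leq_card_setU _ _).
  have c2 : (#|\bigcup_i bad i| <= \sum_i #|bad i|)%N.
    elim/big_rec2: _ => [|i A m _ h]; first by rewrite cards0.
    by apply: leq_trans (leq_card_setU _ _) _; rewrite leq_add2l.
  have c3 : (n.+3 * \sum_i #|bad i| <= n.+2 * #|B| ^ n.+2)%N.
    rewrite big_distrr /= -[X in (_ <= X * _)%N](card_ord n.+2) -sum_nat_const.
    by apply: leq_sum => i _; apply: cbad.
  have {c1 c2}c1 : (#|B| ^ n.+2 <= #|good| + \sum_i #|bad i|)%N.
    by apply: leq_trans c1 _; rewrite leq_add2l.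
  have : (n.+3 * #|B| ^ n.+2 <= n.+3 * #|good| + n.+2 * #|B| ^ n.+2)%N.
    apply: leq_trans (leq_mul (leqnn _) c1) _.
    by rewrite mulnDr leq_add2l.
  by rewrite mulSn leq_add2r.
have cZ : (#|good| <= #|G| * #|Z|)%N.
  rewrite mulnC -[#|G|]cardsT -cardsX.
  have inj : injective (fun u => (cyclic_shift y u, u ord0)).
    by move=> u u' [/cyclic_shift_inj h /h].
  rewrite -(card_imset _ inj); apply/subset_leq_card/subsetP => x /imsetP [u].
  rewrite !inE => /andP [_ /forallP gu] -> /=.
  rewrite sum_cyclic_shift y0 eqxx /= andbT.
  by apply/forallP => i; rewrite ffunE.
have cnt : #|Z|%:R * tau ^+ n.+2 <= zero_sum_count g.
  pose large (x : {ffun 'I_n.+2 -> G}) := [forall i, (tau < g i (x i))%R].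
  rewrite /zero_sum_count (bigID large) /=.
  rewrite -[leLHS]addr0 lerD ?sumr_ge0 //; last by move=> x _; apply: prodr_ge0.
  rewrite mulr_natl -sumr_const big_mkcond [leRHS]big_mkcond /=; apply: ler_sum => x _.
  rewrite inE; case: ifP => // /andP [_ /forallP h].
  rewrite -[X in tau ^+ X](card_ord n.+2) -prodr_const; apply: ler_prod => i _.
  by rewrite tau0 ltW.
rewrite exprMn; apply: (@le_trans _ _ (n.+3%:R * #|G|%:R * (#|Z|%:R * tau ^+ n.+2))).
  rewrite mulrA; apply: ler_wpM2r; first exact: exprn_ge0.
  by rewrite -natrX -!natrM ler_nat -mulnA (leq_trans cgood) // leq_mul2l cZ orbT.
by apply: ler_wpM2l; rewrite ?mulr_ge0.
Qed.

End CyclicShift.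

(** * Removal in finite abelian groups *)

Section Smooth.
Variables (R : realType) (G : finZmodType).
Implicit Types (B S : {set G}) (f g h : G -> R).

Lemma smooth_ge0 B f x : (forall x, 0 <= f x) -> 0 <= smooth B f x.
Proof.
by move=> f0; rewrite divr_ge0 ?sqr_ge0 //; apply: sumr_ge0 => b _; apply: sumr_ge0.
Qed.

(** The law of [b - b'] is symmetric. *)
Lemma smooth_adjoint B f g :
  \sum_x f x * smooth B g x = \sum_x smooth B f x * g x.
Proof.
rewrite /smooth; under eq_bigr => x _ do rewrite mulrA.
under [RHS]eq_bigr => x _ do rewrite mulrAC.
rewrite -!mulr_suml; congr (_ / _).
under eq_bigr => x _.
  rewrite mulr_sumr; under eq_bigr => b _ do rewrite mulr_sumr.
  over.
under [RHS]eq_bigr => x _.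
  rewrite mulr_suml; under eq_bigr => b _ do rewrite mulr_suml.
  over.
rewrite exchange_big [RHS]exchange_big /=.
under eq_bigr => b _ do rewrite exchange_big.
under [RHS]eq_bigr => b _ do rewrite exchange_big.
rewrite exchange_big /=; apply: eq_bigr => b _; apply: eq_bigr => b' _.
rewrite [RHS](reindex_inj (addIr (b' - b))) /=; apply: eq_bigr => x _.
by rewrite -(opprB b b') subrK.
Qed.

(* Markov's inequality for the proportion of bad pairs around [x]; by self-adjointness
   of the smoothing, the average over [S] of that proportion is the mass which
   [smooth B (ind S)] puts on [{g <= tau}]. *)
Lemma card_bad_le B S g (tau : R) (m : nat) : (0 < #|B|)%N ->
  #|[set x in S | (#|B| ^ 2 < m * #|[set p in setX B B | (g (x + (p.1 - p.2)) <= tau)%R]|)%N]|%:R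
  <= m%:R * \sum_x smooth B (ind R S) x * (g x <= tau)%R%:R.
Proof.
move=> B0; set bad := [set x in S | _].
have Bp : 0 < #|B|%:R ^+ 2 :> R by rewrite exprn_gt0 ?ltr0n.
have -> : #|bad|%:R = \sum_x ind R bad x by rewrite sum_ind.
rewrite -smooth_adjoint mulr_sumr; apply: ler_sum => x _.
have -> : smooth B (fun x => (g x <= tau)%R%:R) x =
    #|[set p in setX B B | (g (x + (p.1 - p.2)) <= tau)%R]|%:R / #|B|%:R ^+ 2 :> R.
  rewrite /smooth; congr (_ / _); rewrite pair_big -sum1_card natr_sum /=.
  rewrite big_mkcond [RHS]big_mkcond /=; apply: eq_bigr => -[b b'] _.
  by rewrite !inE /=; case: (b \in B) => //=; case: (b' \in B) => //=; case: (_ <= _).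
rewrite /ind !inE; case: (x \in S) => /=; last by rewrite mul0r mulr0.
rewrite mul1r mulrA ler_pdivlMr //; case: ltnP => h; last by rewrite mul0r mulr_ge0.
by rewrite mul1r -natrX -natrM ler_nat ltnW.
Qed.

(** Cauchy-Schwarz in its AM-GM form, with a free parameter [mu]. *)
Lemma sum_norm_le (d : G -> R) (mu : R) : 0 < mu ->
  \sum_x `|d x| <= (#|G|%:R * mu + (\sum_x d x ^+ 2) / mu) / 2.
Proof.
move=> mu0.
have -> : #|G|%:R * mu = \sum_(x : G) mu by rewrite sumr_const mulr_natl.
rewrite mulr_suml -big_split mulr_suml /=; apply: ler_sum => x _.
rewrite ler_pdivlMr // -(ler_pM2r mu0) mulrDl divfK ?lt0r_neq0 //.
by have := sqr_ge0 (`|d x| - mu); rewrite -[d x ^+ 2]real_normK ?num_real //; nra.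
Qed.

(** Where [g <= tau] one has [h <= tau + |h - g|], and Cauchy-Schwarz bounds the L1 norm of
    [h - g]. *)
Lemma low_mass_le (g h : G -> R) (tau t : R) : 0 <= tau -> 0 < t -> 
  (forall x, 0 <= g x) -> \sum_x (h x - g x) ^+ 2 <= t ^+ 2 ->
  \sum_x h x * (g x <= tau)%R%:R <=
     #|G|%:R * tau + t * Num.sqrt #|G|%:R.
Proof.
move=> tau0 t0 g0 d2.
have G0 : 0 < #|G|%:R :> R by rewrite ltr0n; apply/card_gt0P; exists 0.
set q := Num.sqrt _; have q0 : 0 < q by rewrite sqrtr_gt0.
have qq : #|G|%:R = q * q by rewrite -expr2 sqr_sqrtr // ltW.
(* With [mu = t / q] both terms of [sum_norm_le] are at most [t * q]. *)
have mu0 : 0 < t / q by rewrite divr_gt0.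
have h1 : \sum_x `|h x - g x| <= t * q.
  apply: le_trans (sum_norm_le _ mu0) _.
  have -> : #|G|%:R * (t / q) = t * q by rewrite qq; field; rewrite lt0r_neq0.
  have : (\sum_x (h x - g x) ^+ 2) / (t / q) <= t * q.
    apply: (@le_trans _ _ (t ^+ 2 / (t / q))); first by rewrite ler_pM2r ?invr_gt0.
    by rewrite le_eqVlt; apply/orP; left; apply/eqP; field; rewrite !lt0r_neq0.
  lra.
apply: le_trans (lerD (lexx _) h1).
have -> : #|G|%:R * tau = \sum_(x : G) tau by rewrite sumr_const mulr_natl.
rewrite -big_split /=; apply: ler_sum => x _.
have := ler_norm (h x - g x); have := normr_ge0 (h x - g x).
case: (lerP (g x) tau) => /= gx; rewrite ?mulr1 ?mulr0; move: (g0 x); lra.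
Qed.

End Smooth.

(** * The effect of smoothing on the number of solutions *)

Section CountError.
Variables (R : realType) (G : finZmodType) (e : G -> G -> R[i]).
Hypothesis eP : pairing e.
Variable (S : 'I_5 -> {set G}).
Hypothesis quadS : forall i, (group_quads (S i))%:R <= #|G|%:R :> R.

Let q : R := Num.sqrt #|G|%:R.

Lemma sqrt_card : 0 < q /\ q ^+ 2 = #|G|%:R.
Proof.
have G0 : 0 < #|G|%:R :> R by rewrite ltr0n; apply/card_gt0P; exists 0.
by rewrite /q sqrtr_gt0 sqr_sqrtr // ltW.
Qed.

Lemma card_le_sqrt i : #|S i|%:R <= 2 * q.
Proof.
have [q0 qq] := sqrt_card.
have := card_sqr_le4 (quadS i); rewrite -qq => h.
have -> : 2 * q = `|2 * q| by rewrite ger0_norm // mulr_ge0 // ltW.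
by rewrite -[#|_|%:R]ger0_norm // -ler_sqr ?nnegrE // !real_normK ?num_real //; lra.
Qed.

(** AM-GM reduces the product to fourth moments. Four factors use the fourth-moment bound; the
    fifth, at [ord0], is left for pointwise estimates. *)
Lemma sum_prod_tail_le :
  \sum_k \prod_(i < 4) Normc.normc (fourier e (ind R (S (lift ord0 i))) k) <= 9 * #|G|%:R ^+ 2.
Proof.
apply: (@le_trans _ _ (\sum_k (\sum_(i < 4) spec e (ind R (S (lift ord0 i))) k ^+ 2) / 4)).
  apply: ler_sum => k _; rewrite !big_ord_recl !big_ord0 /spec.
  move: (Normc.normc _) (Normc.normc _) (Normc.normc _) (Normc.normc _) => a b c d.
  have := sqr_ge0 (a * b - c * d); have := sqr_ge0 (a ^+ 2 - b ^+ 2).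
  have := sqr_ge0 (c ^+ 2 - d ^+ 2).
  by rewrite !exprMn; nra.
rewrite -mulr_suml exchange_big ler_pdivrMr //=.
have -> : 9 * #|G|%:R ^+ 2 * 4 = \sum_(i < 4) 9 * #|G|%:R ^+ 2 :> R.
  by rewrite !big_ord_recl big_ord0; ring.
by apply: ler_sum => i _; apply: energy_le.
Qed.

(** Where the spectrum of [S ord0] is large, its transform is at most [2 * q] and [1 - m^5 <= 5 z],
    with [m] the multiplier; elsewhere the transform is at most [z * q]. Either way the product is
    at most [11 * z * q], and the other factors contribute [9 * #|G| ^+ 2]. *)
Lemma count_error_le (B : {set G}) (z : R) : 0 < z ->
  (forall k, z ^+ 2 * #|G|%:R <= spec e (ind R (S ord0)) k -> 1 - z <= mult e B k) ->
  \sum_k (\prod_i Normc.normc (fourier e (ind R (S i)) k)) * (1 - mult e B k ^+ #|'I_5|)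
   <= 99 * z * q * #|G|%:R ^+ 2.
Proof.
move=> z0 near; have [q0 qq] := sqrt_card.
have nn f k : 0 <= Normc.normc (fourier e f k) by case: (fourier _ _ _) => a b; apply: sqrtr_ge0.
apply: (@le_trans _ _ (11 * z * q * (9 * #|G|%:R ^+ 2))); last by lra.
apply: le_trans (ler_wpM2l _ sum_prod_tail_le); last by rewrite !mulr_ge0 // ltW.
rewrite mulr_sumr; apply: ler_sum => k _.
rewrite [X in X * _ <= _]big_ord_recl [leLHS]mulrAC.
apply: ler_wpM2r; first exact: prodr_ge0.
have m0 := mult_ge0 e B k; have m1 := mult_le1 eP B k.
set a := Normc.normc _; have a0 : 0 <= a by apply: nn.
have aS : a <= 2 * q.
  by apply: le_trans (card_le_sqrt ord0); rewrite -sum_ind normc_fourier_le // => x; apply: ind_ge0.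
rewrite card_ord; set m := mult e B k in m0 m1 *.
have m5 : 0 <= m ^+ 5 by rewrite exprn_ge0.
have [big|small] := lerP (z ^+ 2 * #|G|%:R) (spec e (ind R (S ord0)) k).
  have bern : 1 - m ^+ 5 <= 5 * (1 - m).
    have -> : 1 - m ^+ 5 = (1 - m) * (1 + m + m ^+ 2 + m ^+ 3 + m ^+ 4) by ring.
    rewrite [leRHS]mulrC ler_wpM2l ?subr_ge0 //.
    have p n : m ^+ n <= 1 by apply: exprn_ile1.
    by have := p 2; have := p 3; have := p 4; lra.
  have zm : 1 - m <= z by have := near k big; rewrite -/m; lra.
  have : 1 - m ^+ 5 <= 5 * z by lra.
  have : 0 <= 1 - m ^+ 5 by rewrite subr_ge0 exprn_ile1.
  move: (1 - _ ^+ _) => w w0 w5.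
  have : a * w <= (2 * q) * (5 * z) by apply: ler_pM.
  have : 0 <= z * q by rewrite mulr_ge0 // ltW.
  lra.
have : a <= z * q.
  rewrite -ler_sqr ?nnegrE // ?mulr_ge0 ?(ltW z0) ?(ltW q0) //.
  by rewrite exprMn qq; apply: ltW.
have : 0 <= z * q by rewrite mulr_ge0 // ltW.
by move: (m ^+ 5) m5 => w w0; nra.
Qed.

End CountError.

Lemma zero_sum_count_ind (R : realType) (G : finZmodType) (I : finType)
    (S : I -> {set G}) :
  zero_sum_count (fun i => ind R (S i)) =
  #|[set y : {ffun I -> G} | [forall i, y i \in S i] && (\sum_i y i == 0)]|%:R.
Proof.
rewrite /zero_sum_count -sum1_card natr_sum big_mkcond [RHS]big_mkcond /=.
apply: eq_bigr => y _; rewrite inE andbC; case: (_ == 0) => //=.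
case: forallP => [yS|nyS]; first by rewrite big1 // => i _; rewrite /ind yS.
have /forallPn [i yi] : ~~ [forall i, y i \in S i] by apply/forallP.
by rewrite (bigD1 i) //= /ind (negbTE yi) mul0r.
Qed.

Lemma group_removal (R : realType) (eps : R) : 0 < eps ->
  exists delta : R, 0 < delta /\ exists n0 : nat,
  forall (G : finZmodType) (e : G -> G -> R[i]) (S : 'I_5 -> {set G}),
  pairing e -> (n0 <= #|G|)%N ->
  (forall i, (group_quads (S i))%:R <= delta * #|G|%:R) ->
  #|[set y : {ffun 'I_5 -> G} | [forall i, y i \in S i] && (\sum_i y i == 0)]|%:R
    <= delta * #|G|%:R * Num.sqrt #|G|%:R ->
  exists Y : 'I_5 -> {set G}, [/\ forall i, Y i \subset S i,
    forall i, #|S i :\: Y i|%:R <= eps * Num.sqrt #|G|%:R &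
    forall y : {ffun 'I_5 -> G}, (forall i, y i \in Y i) -> \sum_i y i != 0].
Proof.
(* The deletion will cost at most [6 * (t * q + t * q) = eps * q], where [q] is the square root of
   [#|G|]. *)
move=> eps0; pose t := eps / 12.
have tp : 0 < t by rewrite divr_gt0.
have epsE : eps = 12 * t by rewrite /t; field.
clearbody t.
(* After multiplication by [#|G|], a surviving solution forces a smoothed count of at least
   [(c t q)^5 / 6 = 200 z q^5], against at most [99 z q^5] from smoothing and [z q^5] from actual
   solutions. *)
pose z (c : R) := c ^+ 5 * t ^+ 5 / 1200.
have zp c : 0 < c -> 0 < z c by move=> c0; rewrite !mulr_gt0 ?exprn_gt0 ?invr_gt0.
have z2p c : 0 < c -> 0 < z c ^+ 2 by move=> c0; rewrite exprn_gt0 ?zp.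
have [||c0 [c0p scales]] := @two_scales R 'I_5 (t ^+ 2) (fun c => z c ^+ 2) z _ _ z2p zp.
- by rewrite card_ord.
- exact: exprn_gt0.
(* The three bounds serve the fourth moments, the L2 bound and the count of solutions; [z] is
   increasing, so [z c0] is at most [z c1] for the [c1] found later. *)
exists (Num.min 1 (Num.min (c0 / 2) (z c0))); split.
  by rewrite !lt_min ltr01 divr_gt0 // zp.
(* This gives [4 <= c0 * q], so that [2 * q], which bounds [#|S i|], is at most half of
   [c0 * #|G|]. *)
exists (Num.trunc (16 / c0 ^+ 2)).+1 => G e S eP Nbig quads sols.
have G0 : 0 < #|G|%:R :> R by rewrite ltr0n; apply/card_gt0P; exists 0.
have [q0 qq] := @sqrt_card R G; set q := Num.sqrt _ in q0 qq sols *.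
move: quads sols; set delta := Num.min _ _ => quads sols.
have d1 : delta <= 1 by rewrite ge_min lexx.
have d2 : delta <= c0 / 2 by rewrite !ge_min lexx orbT.
have d3 : delta <= z c0 by rewrite !ge_min lexx !orbT.
have q4 : 4 <= c0 * q.
  have : 16 <= c0 ^+ 2 * #|G|%:R.
    rewrite mulrC -ler_pdivrMr ?exprn_gt0 //; apply/ltW/(lt_le_trans (truncnS_gt _)).
    by rewrite ler_nat.
  by rewrite -qq => h; rewrite -ler_sqr ?nnegrE ?mulr_ge0 ?(ltW c0p) ?(ltW q0) // exprMn; lra.
have quad1 i : (group_quads (S i))%:R <= #|G|%:R :> R.
  by apply: le_trans (quads i) _; rewrite ler_piMl.
have l2 (B : {set G}) : c0 * #|G|%:R <= #|B|%:R -> l2_bounded e S B.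
  move=> cB i; apply: sum_spec_mult_le => //; last first.
    by rewrite -(ltr0n R); apply: lt_le_trans cB; rewrite mulr_gt0.
  apply: le_trans cB; have := card_le_sqrt quad1 i; have := quads i; rewrite -/q -qq.
  have : delta * q ^+ 2 <= c0 / 2 * q ^+ 2 by rewrite ler_wpM2r ?sqr_ge0.
  have : 4 * q <= c0 * q * q by rewrite ler_pM2r.
  by rewrite expr2; lra.
have [c1 [B1 [B2 [c01 cB1 gapB near]]]] :=
  scales G e S ord0 eP (fun i => energy_le eP (quad1 i)) l2.
have c1p : 0 < c1 by apply: lt_le_trans c01.
have B1p : (0 < #|B1|)%N by rewrite -(ltr0n R); apply: lt_le_trans cB1; rewrite mulr_gt0.
pose g i := smooth B2 (ind R (S i)).
have g0 i x : 0 <= g i x by apply: smooth_ge0 => u; apply: ind_ge0.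
(* The factor 6 leaves room for five coordinates in [zero_sum_count_ge]; [t / q] is on the scale of
   the density of [S i], which is at most [2 / q]. *)
pose bad i := [set x in S i |
  (#|B1| ^ 2 < 6 * #|[set p in setX B1 B1 | (g i (x + (p.1 - p.2)) <= t / q)%R]|)%N].
exists (fun i => S i :\: bad i); split => [i|i|y yY].
- exact: subsetDl.
- have -> : S i :\: (S i :\: bad i) = bad i.
    by apply/setP => x; rewrite !inE; case: (x \in S i); rewrite ?andbF ?andbT ?negbK.
  apply: le_trans (card_bad_le _ _ _ _ B1p) _.
  have -> : eps * q = 6%:R * (#|G|%:R * (t / q) + t * q).
    by rewrite -qq epsE; field; rewrite lt0r_neq0.
  rewrite ler_pM2l ?ltr0n //; apply: low_mass_le => //; first by rewrite ltW // divr_gt0.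
  rewrite -(ler_pM2l G0) -(parseval eP).
  under eq_bigr => k _ do rewrite (spec_smooth_diff eP).
  rewrite [leRHS]mulrC; apply: le_trans gapB; rewrite [leRHS](bigD1 i) //= ler_wpDr //.
  apply: sumr_ge0 => j _; apply: sumr_ge0 => k _.
  by rewrite mulr_ge0 ?spec_ge0 ?sqr_ge0.
apply/eqP => sum0.
have few i : (6 * #|[set p in setX B1 B1 | (g i (y i + (p.1 - p.2)) <= t / q)%R]| <= #|B1| ^ 2)%N.
  have := yY i; rewrite !inE negb_and => /andP [/orP [/negbTE -> //|]].
  by rewrite -leqNgt.
have tq0 : 0 <= t / q by rewrite ltW // divr_gt0.
have lower := zero_sum_count_ge tq0 g0 sum0 few.
have upper := smooth_count_le eP B2 (fun i => ind R (S i)).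
have err := count_error_le eP quad1 (zp c1 c1p) near.
rewrite -/q in err; rewrite zero_sum_count_ind in upper.
have main : (c1 * t * q) ^+ 5 <= 6%:R * #|G|%:R * zero_sum_count g.
  apply: le_trans lower; rewrite ler_pXn2r ?nnegrE ?mulr_ge0 ?invr_ge0 //;
    rewrite ?(ltW c1p) ?(ltW tp) ?(ltW q0) //.
  rewrite mulrA ler_pdivlMr //; move: cB1; rewrite -qq => cB1.
  have -> : c1 * t * q * q = c1 * q ^+ 2 * t by ring.
  by rewrite ler_wpM2r // ltW.
have zc : delta <= z c1.
  apply: le_trans d3 _; rewrite /z ler_pM2r ?invr_gt0 // ler_pM2r ?exprn_gt0 //.
  by rewrite ler_pXn2r ?nnegrE ?(ltW c0p) ?(ltW c1p).
have main' : 200 * z c1 * q ^+ 5 <= #|G|%:R * zero_sum_count g.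
  have -> : 200 * z c1 * q ^+ 5 = (c1 * t * q) ^+ 5 / 6%:R by rewrite /z; field.
  by rewrite ler_pdivrMr //; move: main; lra.
have zq : 0 < z c1 * q ^+ 5 by rewrite mulr_gt0 ?zp ?exprn_gt0.
have sols' : #|G|%:R *
      #|[set y : {ffun 'I_5 -> G} | [forall i, y i \in S i] && (\sum_i y i == 0)]|%:R
    <= z c1 * q ^+ 5.
  apply: le_trans (ler_wpM2l (ltW G0) sols) _; rewrite -qq.
  have -> : q ^+ 2 * (delta * q ^+ 2 * q) = delta * q ^+ 5 by ring.
  by rewrite ler_wpM2r // exprn_ge0 // ltW.
have err' : 99 * z c1 * q * #|G|%:R ^+ 2 = 99 * (z c1 * q ^+ 5) by rewrite -qq; ring.
rewrite err' in err; move: upper main'; rewrite -/g -mulrA; lra.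
Qed.

(** * Transfer to the integers *)

Lemma closed_prim_root_exists (C : numClosedFieldType) n :
  (0 < n)%N -> exists w : C, n.-primitive_root w.
Proof.
move=> n0; have [r Er] := closed_field_poly_normal ('X^n - 1 : {poly C}).
rewrite (monicP (monicXnsubC _ n0)) scale1r in Er.
have unity : all n.-unity_root r by apply/allP => x; rewrite -root_prod_XsubC -Er.
have [||w _ wP] := hasP (has_prim_root n0 unity _ _); last by exists w.
  by rewrite -separable_prod_XsubC -Er separable_Xn_sub_1 // pnatr_eq0 -lt0n.
by rewrite -ltnS -(size_prod_XsubC r id) -Er size_XnsubC.
Qed.

(** The characters are powers of a primitive root of unity, and orthogonality is the vanishing of a
    geometric sum. *)
Lemma cyclic_pairing (R : realType) m :
  exists e : 'I_m.+1 -> 'I_m.+1 -> R[i], pairing e.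
Proof.
have [w wP] := @closed_prim_root_exists R[i] _ (ltn0Sn m).
have w1 j : (w ^+ j) ^+ m.+1 = 1 by rewrite exprAC (prim_expr_order wP) expr1n.
exists (fun k x => w ^+ (k * x)); split => [k x y|k x|x].
- by rewrite !exprM -exprD -(expr_mod (x + y) (w1 k)).
- rewrite -sqr_normc; have /eqP : `|w ^+ (k * x)| ^+ m.+1 = 1 by rewrite -normrX w1 normr1.
  by rewrite pexpr_eq1 // => /eqP ->; rewrite expr1n.
under eq_bigr => k _ do rewrite mulnC exprM.
have [->|x0] := eqVneq x 0.
  by under eq_bigr => k _ do rewrite expr0 expr1n; rewrite sumr_const.
have /eqP := subrX1 (w ^+ x) m.+1; rewrite w1 subrr eq_sym mulf_eq0 subr_eq0.
rewrite -(prim_order_dvd wP) /dvdn modn_small // => /orP [|/eqP //].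
by move=> /eqP x00; case/eqP: x0; apply: val_inj.
Qed.

Section Residue.
Variable (m : nat).

Definition residue (z : int) : 'I_m.+1 := inZp 1 *~ z.

Lemma residue_eq0 (z : int) : (`|z|%N < m.+1)%N -> residue z = 0 -> z = 0.
Proof.
have nat_res k : (k < m.+1)%N -> (inZp 1 : 'I_m.+1) *+ k = 0 -> k = 0%N.
  have -> : (inZp 1 : 'I_m.+1) *+ k = inZp k.
    elim: k => [|k IH]; first exact: val_inj.
    by apply: val_inj; rewrite mulrS IH /= modnDm add1n.
  by move=> k_lt /(congr1 val) /=; rewrite modn_small.
case: z => k; rewrite /residue; first by move=> lt_k /(nat_res k lt_k) ->.
rewrite NegzE abszN mulrNz => lt_k /eqP; rewrite oppr_eq0 => /eqP h.
by have := nat_res k.+1 lt_k h.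
Qed.

Lemma residueB z1 z2 : residue (z1 - z2) = residue z1 - residue z2.
Proof. exact: mulrzBr. Qed.

Lemma residueD z1 z2 : residue (z1 + z2) = residue z1 + residue z2.
Proof. exact: mulrzDr. Qed.

Lemma residue_sum (I : finType) (F : I -> int) :
  residue (\sum_i F i) = \sum_i residue (F i).
Proof. exact: (big_morph residue residueD (mulr0z _)). Qed.

End Residue.

Section Transfer.
Variables (n m : nat) (a : int).
Hypotheses (a0 : a != 0) (big : (2 * `|a|%N * n < m.+1)%N).

Definition dilate (x : 'I_n.+1) : 'I_m.+1 := residue m (a * x%:Z).

Lemma dilate_inj : injective dilate.
Proof.
move=> x y /eqP; rewrite -subr_eq0 -residueB -mulrBr => /eqP /residue_eq0 h.
have /eqP : a * (x%:Z - y%:Z) = 0.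
  apply: h; rewrite abszM; apply: leq_ltn_trans big.
  have := ltn_ord x; have := ltn_ord y; rewrite !ltnS => xn yn.
  have : (`|(x%:Z - y%:Z)%R|%N <= n)%N by lia.
  by move=> h; apply: leq_trans (leq_mul (leqnn _) h) _; rewrite -mulnA leq_pmull.
by rewrite mulf_eq0 (negbTE a0) subr_eq0 => /eqP [] /val_inj.
Qed.

(** The integer [a (x1 + x2 - x3 - x4)] is at most [2 |a| n] in absolute value, so it vanishes
    modulo [m.+1] only if it is 0: dilation creates no new quadruples. *)
Lemma group_quads_dilate (X : {set 'I_n.+1}) :
  (group_quads (dilate @: X) <= nontriv_quads X)%N.
Proof.
pose h (q : 'I_n.+1 * 'I_n.+1 * 'I_n.+1 * 'I_n.+1) :=
  (dilate q.1.1.1, dilate q.1.1.2, dilate q.1.2, dilate q.2).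
rewrite /nontriv_quads; set Q := [set q | _].
apply: leq_trans (leq_imset_card h _); apply/subset_leq_card/subsetP => -[[[u1 u2] u3] u4].
rewrite inE /= => /and5P [/imsetP [x1 X1 ->] /imsetP [x2 X2 ->] /imsetP [x3 X3 ->]].
move=> /imsetP [x4 X4 ->] /and3P [/eqP E n13 n14].
apply/imsetP; exists (x1, x2, x3, x4) => //.
rewrite inE /= X1 X2 X3 X4 /=; apply/andP; split; last first.
  rewrite negb_or !negb_and; apply/andP; split.
    by apply/orP; left; apply: contra n13 => /eqP ->.
  by apply/orP; left; apply: contra n14 => /eqP ->.
have E0 : residue m (a * (x1%:Z + x2%:Z - (x3%:Z + x4%:Z))) = 0.
  by rewrite mulrBr !mulrDr residueB !residueD -!/(dilate _) E subrr.
have bound : (`|(a * (x1%:Z + x2%:Z - (x3%:Z + x4%:Z)))%R|%N < m.+1)%N.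
  rewrite abszM; apply: leq_ltn_trans big.
  move: (ltn_ord x1) (ltn_ord x2) (ltn_ord x3) (ltn_ord x4) => l1 l2 l3 l4.
  have h4 : (`|(x1%:Z + x2%:Z - (x3%:Z + x4%:Z))%R|%N <= 2 * n)%N by lia.
  by apply: leq_trans (leq_mul (leqnn _) h4) _; rewrite mulnCA mulnA.
by have /eqP := residue_eq0 bound E0; rewrite mulf_eq0 (negbTE a0) /= subr_eq0 => /eqP [->].
Qed.

End Transfer.

Theorem theorem1p17 (R : realType) (a : 'I_5 -> int)
  (ha0 : forall i, a i != 0) (hsum : \sum_(i < 5) a i = 0) :
  forall eps : R, 0 < eps ->
  exists delta : R, 0 < delta /\
  exists n0 : nat, forall n : nat, (n0 <= n)%N ->
  forall X : 'I_5 -> {set 'I_n.+1},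
    (forall i, ord0 \notin X i) ->
    (forall i, (nontriv_quads (X i))%:R <= delta * n%:R) ->
    (lin_solutions a X)%:R <= delta * n%:R * Num.sqrt (n%:R) ->
    exists Y : 'I_5 -> {set 'I_n.+1},
      (forall i, Y i \subset X i) /\
      (forall i, #|X i :\: Y i|%:R <= eps * Num.sqrt (n%:R)) /\
      lin_solutions a Y = 0%N.
Proof.
(* [A] is large enough that neither quadruples nor the equation wrap around modulo [A n + 1]. *)
move=> eps eps0; pose A := (2 * \sum_(i < 5) `|a i|)%N.
have leA i : (2 * `|a i|%N <= A)%N by rewrite leq_mul2l (bigD1 i) //= leq_addr.
have A0 : (0 < A)%N.
  by apply: leq_trans (leA ord0); rewrite muln_gt0 absz_gt0 ha0.
(* The division by [A + 1] compensates for the modulus, whose square root is at most [A + 1] times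
   that of [n] once [n >= 1]. *)
have [|delta [delta0 [n0 removal]]] := @group_removal R (eps / A.+1%:R).
  by rewrite divr_gt0 // ltr0n.
exists delta; split => //; exists (maxn n0 1) => n.
rewrite geq_max => /andP [n0n n1] X _ quads sols.
pose m := (A * n)%N.
have big i : (2 * `|a i|%N * n < m.+1)%N by rewrite ltnS leq_mul2r leA orbT.
have nm : (n <= m)%N by rewrite leq_pmull.
pose phi i : 'I_n.+1 -> 'I_m.+1 := dilate m (a i).
have phi_inj i : injective (phi i) by apply: dilate_inj (ha0 i) (big i).
have phi_sum (x : 'I_5 -> 'I_n.+1) :
    (\sum_i phi i (x i) == 0) = (\sum_i a i * (x i)%:Z == 0).
  rewrite /phi /dilate -residue_sum; apply/eqP/eqP => [|->]; last exact: mulr0z.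
  apply: residue_eq0; rewrite ltnS.
  apply: (@leq_trans (\sum_i `|a i| * n)).
    elim/big_ind2: _ => // [z1 k1 z2 k2 h1 h2|i _]; first by lia.
    by rewrite abszM leq_mul2l -ltnS ltn_ord orbT.
  by rewrite -big_distrl leq_mul2r /= /A leq_pmull ?orbT.
have [e eP] := cyclic_pairing R m.
have cG : #|'I_m.+1| = m.+1 by rewrite card_ord.
have sqrt_le : Num.sqrt n%:R <= Num.sqrt #|'I_m.+1|%:R :> R.
  by rewrite ler_sqrt // ler_nat cG ltnW.
have nG : n%:R <= #|'I_m.+1|%:R :> R by rewrite ler_nat cG ltnW.
have [|i||Y [YS Ysmall Yfree]] := removal _ e (fun i => phi i @: X i) eP.
- by rewrite cG; apply: leq_trans n0n (ltnW _).
- apply: (@le_trans _ _ (nontriv_quads (X i))%:R).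
    by rewrite ler_nat group_quads_dilate.
  by apply: le_trans (quads i) _; rewrite ler_pM2l.
- apply: (@le_trans _ _ (lin_solutions a X)%:R).
    rewrite ler_nat /lin_solutions.
    apply: leq_trans (leq_imset_card (fun x : {ffun 'I_5 -> 'I_n.+1} => [ffun i => phi i (x i)]) _).
    apply/subset_leq_card/subsetP => y; rewrite inE => /andP [/forallP yS y0].
    have yP i : exists x, (x \in X i) && (y i == phi i x).
      by have /imsetP [x xX ->] := yS i; exists x; rewrite xX eqxx.
    pose x := [ffun i => xchoose (yP i)].
    have xP i : x i \in X i /\ y i = phi i (x i).
      by rewrite ffunE; have /andP [? /eqP ?] := xchooseP (yP i).
    apply/imsetP; exists x; last by apply/ffunP => i; rewrite ffunE; case: (xP i).
    rewrite inE -phi_sum; apply/andP; split; first by apply/forallP => i; case: (xP i).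
    rewrite (eq_bigr y) // => i _; by have [_ ->] := xP i.
  apply: le_trans sols _; apply: ler_pM;
    by rewrite ?sqrtr_ge0 ?mulr_ge0 ?ler_pM2l ?(ltW delta0).
exists (fun i => [set x in X i | phi i x \in Y i]); split; last split.
- by move=> i; apply/subsetP => x; rewrite inE => /andP [].
- move=> i; apply: (@le_trans _ _ (eps / A.+1%:R * Num.sqrt #|'I_m.+1|%:R)).
    apply: le_trans (Ysmall i); rewrite ler_nat -(card_imset _ (phi_inj i)).
    apply/subset_leq_card/subsetP => u /imsetP [x]; rewrite !inE => /andP [+ xX] ->.
    by rewrite xX /= => ->; rewrite imset_f.
  rewrite -mulrA ler_pM2l // mulrC ler_pdivrMr ?ltr0n // cG.
  have An : m.+1%:R <= A.+1%:R * n%:R :> R.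
    by rewrite -natrM ler_nat mulSn addnC -addn1 leq_add2l.
  have A1 : 1 <= A.+1%:R :> R by rewrite ler1n.
  apply: (@le_trans _ _ (Num.sqrt (A.+1%:R ^+ 2 * n%:R))).
    rewrite ler_sqrt ?mulr_ge0 ?exprn_ge0 //; apply: le_trans An _.
    by rewrite ler_wpM2r // expr2 ler_peMl.
  by rewrite sqrtrM ?exprn_ge0 // sqrtr_sqr ger0_norm // mulrC.
apply/eqP; rewrite cards_eq0; apply/eqP/setP => x; rewrite !inE; apply/negP.
case/andP => /forallP xY; rewrite -phi_sum => x0.
have : \sum_i [ffun i => phi i (x i)] i != 0.
  by apply: Yfree => i; rewrite ffunE; have := xY i; rewrite inE => /andP [].
by under eq_bigr => i _ do rewrite ffunE; rewrite x0.
Qed.
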